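(* Let $A$ be a finite set with at least two elements. Assume that each voter either plumps for a single option or abstains; let $f_x\ge0$ be the fraction of voters who choose $x\in A$, so that $\sum_{x\in A}f_x=f\le1$, where $f$ is the fraction of non-empty votes, and the Llull matrix of the vote is given by $v_{xy}=f_x$ for all $x\in A$ and all $y\ne x$. Then the fraction-like rates satisfy $\varphi_x=f_x$ for every $x\in A$.
   Context: Let $A$ be a finite set with $N\ge2$ elements and $\Pi$ the set of ordered pairs $xy$ with $x,y\in A$, $x\ne y$. A relation on $A$ is a subset of $\Pi$. A Llull matrix on $A$ is a family $v=(v_{xy})_{xy\in\Pi}$ with $v_{xy}\in[0,1]$ and $v_{xy}+v_{yx}\le1$. Turnovers: $t_{xy}=v_{xy}+v_{yx}$. Indirect scores: $v^*_{xy}=\max\min_{0\le i<n}v_{x_ix_{i+1}}$, the max being over all paths $x_0x_1\dots x_n$ ($n\ge1$, consecutive elements distinct) with $x_0=x$, $x_n=y$. Put $m^\nu_{xy}=v^*_{xy}-v^*_{yx}$, $\nu=\{xy\in\Pi: m^\nu_{xy}>0\}$, $\hat\nu=\{xy\in\Pi: m^\nu_{xy}\ge0\}$. An admissible order is a (strict) total order $\xi\subseteq\Pi$ with $\nu\subseteq\xi\subseteq\hat\nu$; one always exists. Write $x\succ y$ for $xy\in\xi$, $x\succeq y$ for $x\succ y$ or $x=y$, and $x'$ for the immediate successor of $x$ in $\xi$ (for $x$ not last). Given an admissible order $\xi$, the projected scores are obtained as follows. (i) For $x\succ y$: $m^\sigma_{xy}=\min\{m^\nu_{pq}: p\succeq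 x,\ y\succeq q\}$. (ii) $(t^\sigma_{xy})_{xy\in\Pi}$ is the unique minimizer of $\sum_{xy\in\Pi}(\tau_{xy}-t_{xy})^2$ among all real families $(\tau_{xy})_{xy\in\Pi}$ such that $\tau_{xy}=\tau_{yx}$ for all $xy$; $m^\sigma_{xx'}\le\tau_{xx'}\le1$ for all non-last $x$; $0\le\tau_{xy}-\tau_{xy'}\le m^\sigma_{yy'}$ for all non-last $y$ and all $x\notin\{y,y'\}$. (iii) $\gamma_{xx'}=[(t^\sigma_{xx'}-m^\sigma_{xx'})/2,\ (t^\sigma_{xx'}+m^\sigma_{xx'})/2]$, and for $x\succ y$, $\gamma_{xy}=\bigcup\{\gamma_{pp'}: x\succeq p\succ y\}$, which is a closed interval. (iv) For $x\succ y$: $v^\pi_{xy}=\max\gamma_{xy}$, $v^\pi_{yx}=\min\gamma_{xy}$. The projected scores do not depend on the choice of $\xi$. Put $t^\pi_{xy}=v^\pi_{xy}+v^\pi_{yx}$. Fraction-like rates: if $v=0$ (full abstention, $f=0$), $\varphi_x=0$ for all $x$. If $v\neq0$ (so $f>0$ and $(v^\pi_{xy})\ne0$): there is a unique nonempty set $X\subseteq A$ (the top dominant irreducible component of $(v^\pi_{xy})$) such that any two distinct elements of $X$ can be joined in both directions by paths along which $v^\pi>0$, every $y\notin X$ can be reached from every $x\in X$ by such a path, and no $x\in X$ can be reached by such a path from any $y\notin X$. Then $\varphi_x=0$ for $x\notin X$, and $(\varphi_x)_{x\in X}$ is the unique family of positive numbers with $\sum_{x\in X}\varphi_x=f$ and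 $\sum_{y\in X,\,y\ne x}t^\pi_{xy}\,\varphi_x/(\varphi_x+\varphi_y)=\sum_{y\in X,\,y\neq x}v^\pi_{xy}$ for all $x\in X$. *)

(* Defs.v *)
From HB Require Import structures.
From mathcomp Require Import all_boot all_order all_algebra.
From mathcomp Require Import all_classical all_reals.

Set Implicit Arguments.
Unset Strict Implicit.
Unset Printing Implicit Defensive.

Import Order.TTheory GRing.Theory Num.Theory.
Local Open Scope classical_set_scope.
Local Open Scope ring_scope.

(** A family indexed by the ordered pairs of distinct elements of [A] is
    represented by a function [A -> A -> R] whose values on the diagonal are
    never used. *)

Section Llull.
Variables (R : realType) (A : finType).
Implicit Types (v t m tau vp : A -> A -> R) (xi : rel A) (phi : A -> R).

Definition zero_scores v : Prop := forall x y, x != y -> v x y = 0.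

Definition turnovers v : A -> A -> R := fun x y => v x y + v y x.

(** Minimum of the scores along the path [x, z, p_1, ..., p_k], which has at
    least one edge. *)
Definition path_score v (x z : A) (p : seq A) : R :=
  \big[Num.min/v x z]_(s <- pairmap v z p) s.

(** The set of path scores is finite, so this supremum is a maximum. *)
Definition indirect_scores v : A -> A -> R := fun x y =>
  sup [set r | exists z p, [/\ path (fun a b => a != b) x (z :: p),
                               last z p = y & r = path_score v x z p]].

Definition indirect_margins v : A -> A -> R := fun x y =>
  indirect_scores v x y - indirect_scores v y x.

Definition strict_total_order xi : Prop :=
  [/\ irreflexive xi, transitive xi
    & forall x y, x != y -> xi x y \/ xi y x].

Definition admissible_order v xi : Prop :=
  [/\ strict_total_order xi,
      forall x y, x != y -> 0 < indirect_margins v x y -> xi x y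
    & forall x y, xi x y -> 0 <= indirect_margins v x y].

Definition weakly xi : rel A := fun x y => (x == y) || xi x y.

(** [y] is the immediate successor of [x], in particular [x] is not last. *)
Definition succ_in xi : rel A := fun x y =>
  xi x y && ~~ [exists z, xi x z && xi z y].

(** Only meaningful for [xi x y]; the pair [(x, y)] itself then belongs to the
    range of the minimum. *)
Definition projected_margins v xi : A -> A -> R := fun x y =>
  \big[Num.min/indirect_margins v x y]_(pq : A * A |
      weakly xi pq.1 x && weakly xi y pq.2) indirect_margins v pq.1 pq.2.

(** Constraints on the turnovers, for given projected margins [m]. *)
Definition feasible_turnovers xi m tau : Prop :=
  [/\ forall x y, x != y -> tau x y = tau y x,
      forall x x', succ_in xi x x' -> m x x' <= tau x x' <= 1
    & forall y y' x, succ_in xi y y' -> x != y -> x != y' ->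
        0 <= tau x y - tau x y' <= m y y'].

Definition square_distance tau t : R :=
  \sum_(xy : A * A | xy.1 != xy.2) (tau xy.1 xy.2 - t xy.1 xy.2) ^+ 2.

Definition projected_turnovers v xi tau : Prop :=
  let m := projected_margins v xi in
  feasible_turnovers xi m tau /\
  forall tau', feasible_turnovers xi m tau' ->
    square_distance tau (turnovers v) <= square_distance tau' (turnovers v).

(** Union of the intervals attached to the pairs [(p, p')] of consecutive
    elements such that [p] is weakly after [x] and strictly before [y]. *)
Definition score_interval xi m tau (x y : A) : set R :=
  \bigcup_(pp in [set pp : A * A |
      [&& weakly xi x pp.1, xi pp.1 y & succ_in xi pp.1 pp.2]])
    `[(tau pp.1 pp.2 - m pp.1 pp.2) / 2, (tau pp.1 pp.2 + m pp.1 pp.2) / 2]%classic.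

(** The sets [score_interval xi m tau x y] are finite unions of compact
    intervals, so the bounds below are attained. *)
Definition projected_scores v xi tau : A -> A -> R := fun x y =>
  let m := projected_margins v xi in
  if xi x y then sup (score_interval xi m tau x y)
  else inf (score_interval xi m tau y x).

Definition positive_edge vp : rel A := fun x y => (x != y) && (0 < vp x y).

(** [connect] is reflexive, but is only used here between distinct elements,
    where it amounts to the existence of a path with at least one edge. *)
Definition top_dominant_component vp (X : {set A}) : Prop :=
  [/\ X != finset.set0,
      forall x y, x \in X -> y \in X -> x != y ->
        connect (positive_edge vp) x y,
      forall x y, x \in X -> y \notin X -> connect (positive_edge vp) x y
    & forall x y, x \in X -> y \notin X -> ~~ connect (positive_edge vp) y x].

Definition rates_on_component vp (F : R) (X : {set A}) phi : Prop :=
  [/\ forall x, x \notin X -> phi x = 0,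
      forall x, x \in X -> 0 < phi x,
      \sum_(x in X) phi x = F
    & forall x, x \in X ->
        \sum_(y in X | y != x) turnovers vp x y * (phi x / (phi x + phi y)) =
        \sum_(y in X | y != x) vp x y].

(** [phi] is a family of fraction-like rates of the Llull matrix [v], where
    [F] is the fraction of non-empty votes. The projected scores do not depend
    on the admissible order, whence the existential quantification on [xi]. *)
Definition fraction_like_rates v (F : R) phi : Prop :=
  (zero_scores v -> forall x, phi x = 0) /\
  (~ zero_scores v ->
     exists xi tau X,
       [/\ admissible_order v xi, projected_turnovers v xi tau,
           top_dominant_component (projected_scores v xi tau) X
         & rates_on_component (projected_scores v xi tau) F X phi]).

End Llull.

(* Main.v *)
(** Every path from [x] starts with a score [f x], so the indirect scores are
    again [f x] and an admissible order sorts [A] by decreasing [f]. The original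
    turnovers [f x + f y] already satisfy the constraints, hence they are the
    projected ones; consecutive intervals are then [[f x', f x]] and the projected
    scores are again [f x]. The top component is the support of [f], on which [f]
    solves the equations for the rates, and the solution is unique. *)
Require Import Defs.
From HB Require Import structures.
From mathcomp Require Import all_boot all_order all_algebra.
From mathcomp Require Import all_classical all_reals.
From mathcomp Require Import ring lra.

Set Implicit Arguments.
Unset Strict Implicit.
Unset Printing Implicit Defensive.

Import Order.TTheory GRing.Theory Num.Theory.
Local Open Scope ring_scope.

Lemma sup_max (R : realType) (E : set R) (m : R) :
  E m -> ubound E m -> sup E = m.
Proof.
move=> Em ubm; apply/eqP; rewrite eq_le; apply/andP; split.
  by apply: ge_sup => //; exists m.
by apply: ub_le_sup => //; exists m.
Qed.

Lemma inf_min (R : realType) (E : set R) (m : R) :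
  E m -> lbound E m -> inf E = m.
Proof.
move=> Em lbm; apply/eqP; rewrite eq_le; apply/andP; split.
  by apply: ge_inf => //; exists m.
by apply: lb_le_inf => //; exists m.
Qed.

Lemma exists_neq (A : finType) (x : A) : (1 < #|A|)%N -> exists y, y != x.
Proof.
move=> A2; have /card_gt0P[y yx] : (0 < #|predC1 x|)%N.
  by rewrite cardC1 -ltnS prednK// ltnW.
by exists y.
Qed.

(** * Neighbours in a finite strict total order *)

Section StrictTotalOrder.
Variables (A : finType) (xi : rel A).
Hypothesis hxi : strict_total_order xi.

Lemma strict_total_order_neq (x y : A) : xi x y -> x != y.
Proof. by case: hxi => irr _ _ xy; apply/eqP => e; rewrite e irr in xy. Qed.

(** Among the finitely many elements after [x], one with the fewest predecessors works: by
    transitivity and irreflexivity, an element strictly in between would have fewer. *)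
Lemma succ_in_exists (x y : A) : xi x y -> exists x', succ_in xi x x'.
Proof.
case: hxi => irr tr _ xy.
case: (@arg_minnP _ y (xi x) (fun z => #|[pred w | xi w z]|) xy) => z xz minz.
exists z; rewrite /succ_in xz; apply/existsPn => w; apply/negP => /andP[xw wz].
have := minz w xw; rewrite leqNgt => /negP; apply; apply: proper_card.
apply/properP; split; first by apply/fintype.subsetP => u; rewrite !inE => /tr; apply.
by exists w; rewrite !inE ?irr.
Qed.

Lemma pred_in_exists (x y : A) : xi x y -> exists y', succ_in xi y' y.
Proof.
case: hxi => irr tr _ xy.
case: (@arg_minnP _ x (xi^~ y) (fun z => #|[pred w | xi z w]|) xy) => z zy minz.
exists z; rewrite /succ_in zy; apply/existsPn => w; apply/negP => /andP[zw wy].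
have := minz w wy; rewrite leqNgt => /negP; apply; apply: proper_card.
apply/properP; split.
  by apply/fintype.subsetP => u; rewrite !inE; apply: tr.
by exists w; rewrite !inE ?irr.
Qed.

Lemma succ_in_weakly_l (x y z : A) : succ_in xi x y -> xi x z -> weakly xi y z.
Proof.
case: hxi => _ _ tot /andP[_ /existsPn nb] xz; rewrite /weakly.
case: eqVneq => //= yz; case: (tot _ _ yz) => // zy.
by have := nb z; rewrite xz zy.
Qed.

Lemma succ_in_weakly_r (x y z : A) : succ_in xi x y -> xi z y -> weakly xi z x.
Proof.
case: hxi => _ _ tot /andP[_ /existsPn nb] zy; rewrite /weakly.
case: eqVneq => //= zx; case: (tot _ _ zx) => // xz.
by have := nb z; rewrite xz zy.
Qed.

End StrictTotalOrder.

(** * From the plumping votes to the projected scores *)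

Section Plumping.
Variables (R : realType) (A : finType) (f : A -> R) (v : A -> A -> R).
Hypothesis hf : forall x : A, 0 <= f x.
Hypothesis hv : forall x y : A, y != x -> v x y = f x.

Lemma plumping_indirect_scores (x y : A) :
  y != x -> indirect_scores v x y = f x.
Proof.
move=> yx; apply: sup_max.
  (* The one-edge path attains the bound set by the first edge. *)
  exists y, [::]; split=> //=; first by rewrite eq_sym yx.
  by rewrite /path_score big_nil hv.
move=> _ [z [p [/= /andP[xz _] _ ->]]].
by rewrite -(@hv x z) 1?eq_sym// bigmin_le_id.
Qed.

Lemma plumping_indirect_margins (x y : A) : indirect_margins v x y = f x - f y.
Proof.
rewrite /indirect_margins; have [->|xy] := eqVneq x y; first by rewrite !subrr.
by rewrite !plumping_indirect_scores // eq_sym.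
Qed.

Lemma plumping_weakly (xi : rel A) (x y : A) :
  admissible_order v xi -> weakly xi x y -> f y <= f x.
Proof.
case=> _ _ h /orP[/eqP->//|/h].
by rewrite plumping_indirect_margins subr_ge0.
Qed.

(** Since [f] decreases weakly along [xi], moving [p] up and [q] down can only increase [f p - f q],
    so the minimum is attained at [(x, y)] itself. *)
Lemma plumping_projected_margins (xi : rel A) (x y : A) :
  admissible_order v xi -> projected_margins v xi x y = f x - f y.
Proof.
move=> adm; rewrite /projected_margins bigmin_eq_id plumping_indirect_margins//.
move=> [p q] /= /andP[px yq]; rewrite plumping_indirect_margins.
by apply: lerB; apply: plumping_weakly adm _.
Qed.

Lemma plumping_turnovers (x y : A) : x != y -> turnovers v x y = f x + f y.
Proof. by move=> xy; rewrite /turnovers !hv// eq_sym. Qed.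

(** The lower bound for neighbours is [f x - f y <= f x + f y], and the upper bound 1 holds because
    two values of [f] add up to at most the total. In the last constraint the difference of
    turnovers equals the margin [f y - f z]. *)
Lemma plumping_feasible_turnovers (xi : rel A) :
  \sum_x f x <= 1 -> admissible_order v xi ->
  feasible_turnovers xi (projected_margins v xi) (turnovers v).
Proof.
move=> f1 adm; have [sto _ _] := adm; split.
- by move=> x y _; rewrite /turnovers addrC.
- move=> x y /andP[xy _]; rewrite plumping_projected_margins//.
  have nxy := strict_total_order_neq sto xy.
  rewrite plumping_turnovers//; apply/andP; split.
    by have := hf y; lra.
  apply: le_trans f1; rewrite (bigD1 x)//= (bigD1 y) 1?eq_sym//= addrA lerDl.
  by rewrite sumr_ge0.
- move=> y z x /andP[yz _] xy xz; rewrite plumping_projected_margins//.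
  rewrite !plumping_turnovers//.
  have := plumping_weakly adm (_ : weakly xi y z); rewrite /weakly yz orbT.
  by move=> /(_ isT); lra.
Qed.

Lemma plumping_projected_turnovers (xi : rel A) (tau : A -> A -> R) (x y : A) :
  \sum_x f x <= 1 -> admissible_order v xi -> projected_turnovers v xi tau ->
  x != y -> tau x y = f x + f y.
Proof.
move=> f1 adm [_ /(_ _ (plumping_feasible_turnovers f1 adm))] le_dist xy.
(* The original turnovers are a competitor at distance 0, so every square in the distance of [tau]
   vanishes. *)
have d0 : square_distance tau (turnovers v) <= 0.
  by rewrite (le_trans le_dist)// /square_distance big1// => p _; rewrite subrr expr0n.
have : square_distance tau (turnovers v) == 0.
  by rewrite eq_le d0 sumr_ge0// => p _; rewrite sqr_ge0.
rewrite psumr_eq0 => [/allP/(_ (x, y) (mem_index_enum _))/=|p _]; last exact: sqr_ge0.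
by rewrite xy/= sqrf_eq0 subr_eq0 => /eqP->; rewrite plumping_turnovers.
Qed.

Lemma plumping_projected_scores (xi : rel A) (tau : A -> A -> R) (x y : A) :
  \sum_x f x <= 1 -> admissible_order v xi -> projected_turnovers v xi tau ->
  x != y -> projected_scores v xi tau x y = f x.
Proof.
move=> f1 adm ptau xy; have [sto _ _] := adm.
have intE p q : succ_in xi p q ->
    `[(tau p q - projected_margins v xi p q) / 2,
      (tau p q + projected_margins v xi p q) / 2]%classic = `[f q, f p]%classic.
  move=> /andP[pq _]; rewrite plumping_projected_margins//.
  rewrite (plumping_projected_turnovers f1 adm ptau).
    have -> : (f p + f q - (f p - f q)) / 2 = f q by field.
    by have -> : (f p + f q + (f p - f q)) / 2 = f p by field.
  exact: strict_total_order_neq pq.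
have wle p q : succ_in xi p q -> f q <= f p.
  by case/andP => pq _; apply: plumping_weakly adm _; rewrite /weakly pq orbT.
rewrite /projected_scores; case: ifPn => [xiy|nxiy].
  (* The interval from [x] to its successor has the highest upper end, [f x]. *)
  apply: sup_max.
    have [x' xx'] := succ_in_exists sto xiy.
    exists (x, x'); first by rewrite /= /weakly eqxx xiy.
    by rewrite (intE x x')//= in_itv/= lexx wle.
  move=> r [[p q]] /and3P[xp _ pq]; rewrite (intE p q)//= in_itv/= => /andP[_ rp].
  exact: le_trans (plumping_weakly adm xp).
have yix : xi y x by case: sto => _ _ /(_ _ _ xy)[] // xiy; rewrite xiy in nxiy.
(* Here [y] precedes [x]; the last interval, from the predecessor of [x] to [x], has the lowest
   lower end, again [f x]. *)
apply: inf_min.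
  have [x' xx'] := pred_in_exists sto yix.
  exists (x', x).
    by rewrite /= xx' (succ_in_weakly_r sto xx' yix); case/andP: xx' => ->.
  by rewrite (intE x' x)//= in_itv/= lexx wle.
move=> r [[p q]] /and3P[_ py pq]; rewrite (intE p q)//= in_itv/= => /andP[qr _].
exact: le_trans (plumping_weakly adm (succ_in_weakly_l sto pq py)) qr.
Qed.

(* Ties of [f] are broken by the rank in the enumeration of [A]. *)
Lemma plumping_admissible_order_exists : exists xi, admissible_order v xi.
Proof.
exists (fun x y => (f y < f x) || (f x == f y) && (enum_rank x < enum_rank y)%N).
split.
- split.
  + by move=> x; rewrite ltxx ltnn andbF.
  + move=> y x z /orP[yx|/andP[/eqP xy rxy]] /orP[zy|/andP[/eqP yz ryz]].
    * by rewrite (lt_trans zy yx).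
    * by rewrite -yz yx.
    * by rewrite xy zy.
    * by rewrite xy yz eqxx (ltn_trans rxy ryz) orbT.
  + move=> x y xy; case: (ltgtP (f x) (f y)) => //= _; [by right|by left|].
    case: (ltngtP (enum_rank x) (enum_rank y)) => //; [by left|by right|].
    by move/val_inj/enum_rank_inj => e; rewrite e eqxx in xy.
- by move=> x y _; rewrite plumping_indirect_margins subr_gt0 => ->.
- move=> x y; rewrite plumping_indirect_margins subr_ge0.
  by case/orP => [/ltW//|/andP[/eqP-> _]].
Qed.

Lemma plumping_zero_scores : (1 < #|A|)%N ->
  zero_scores v <-> forall x, f x = 0.
Proof.
move=> A2; split=> [v0 x|f0 x y xy]; last by rewrite hv 1?eq_sym.
have [y yx] := exists_neq x A2; by rewrite -(hv yx) v0// eq_sym.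
Qed.

End Plumping.

(** * Top component and rates when each row of scores is constant *)

Section RowConstantScores.
Variables (R : realType) (A : finType) (f : A -> R) (vp : A -> A -> R).
Hypothesis hf : forall x : A, 0 <= f x.
Hypothesis hvp : forall x y : A, x != y -> vp x y = f x.

(** All edges leaving [x] have score [f x]: either none is positive, or the direct edge to [y]
    is. *)
Lemma row_constant_connect (x y : A) :
  x != y -> connect (positive_edge vp) x y = (0 < f x).
Proof.
move=> xy; apply/idP/idP => [/connectP[[/=|z p /= /andP[/andP[xz]]]]|fx].
- by move=> _ e; rewrite e eqxx in xy.
- by rewrite hvp.
- by apply: connect1; rewrite /positive_edge xy hvp.
Qed.

Lemma row_constant_top_dominant_component (X : {set A}) :
  (1 < #|A|)%N -> (exists x, f x != 0) ->
  top_dominant_component vp X <-> X = [set x | 0 < f x]%SET.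
Proof.
move=> A2 [x0 fx0]; split=> [[/set0Pn[z zX] XX XC CX]|->]; last first.
  split.
  - by apply/set0Pn; exists x0; rewrite inE lt_neqAle eq_sym fx0 hf.
  - by move=> x y; rewrite !inE => fx _ xy; rewrite row_constant_connect.
  - move=> x y; rewrite !inE => fx nfy; rewrite row_constant_connect//.
    by apply: contraNneq nfy => <-.
  - move=> x y; rewrite !inE => fx nfy; rewrite row_constant_connect//.
    by apply: contraNneq nfy => ->.
apply/setP => x; rewrite inE; apply/idP/idP => [xX|fx].
  (* A member of [X] reaches any other element, inside or outside [X], which forces [f x] to be
     positive. *)
  have [y yx] := exists_neq x A2; rewrite -(@row_constant_connect x y) 1?eq_sym//.
  by have [yX|yX] := boolP (y \in X); [apply: XX => //; rewrite eq_sym|apply: XC].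
(* Outside [X] the element [z] of [X] is out of reach, so [f x] is not positive. *)
apply: contraLR fx => nxX; rewrite -(@row_constant_connect x z) ?CX//.
by apply: contraNneq nxX => ->.
Qed.

(* Compare the equation at a maximizer [x] of [phi x / f x] termwise: each
   summand [(f x + f y) * phi x / (phi x + phi y)] is at least [f x], hence all
   ratios are equal. *)
Lemma row_constant_rates_unique (X : {set A}) (phi : A -> R) :
  X != finset.set0 -> (forall x, x \in X -> 0 < f x) ->
  rates_on_component vp (\sum_(x in X) f x) X phi ->
  forall x, x \in X -> phi x = f x.
Proof.
move=> /set0Pn[x0 x0X] fX [_ phiX sumphi eqX].
case: (arg_maxP (fun x => phi x / f x) x0X) => x xX maxx.
set r := phi x / f x.
have fx := fX _ xX; have px := phiX _ xX.
have phix : phi x = r * f x by rewrite divfK// gt_eqF.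
have le_phi y : y \in X -> phi y <= r * f y.
  by move=> yX; rewrite -ler_pdivrMr ?fX//; apply: maxx.
have eqphi y : y \in X -> phi y = r * f y.
  have termE z : z \in X -> z != x ->
      turnovers vp x z * (phi x / (phi x + phi z)) - vp x z =
      (f x * (r * f z - phi z)) / (phi x + phi z).
    move=> zX zx; rewrite /turnovers !hvp// 1?eq_sym//.
    have pz := phiX _ zX; have nz : phi x + phi z != 0 by rewrite gt_eqF// addr_gt0.
    by move: nz; rewrite phix => nz; field.
  have term_ge0 z : z \in X -> 0 <= (f x * (r * f z - phi z)) / (phi x + phi z).
    move=> zX; rewrite divr_ge0 ?mulr_ge0 ?subr_ge0 ?le_phi ?(ltW fx)//.
    by rewrite addr_ge0// ltW// phiX.
  (* The equation at the maximizer [x] says that these nonnegative excesses sum to zero. *)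
  have : \sum_(z in X | z != x) (f x * (r * f z - phi z)) / (phi x + phi z) == 0.
    under eq_bigr => z /andP[zX zx] do rewrite -termE//.
    by rewrite sumrB eqX// subrr.
  rewrite psumr_eq0 => [/allP h yX|z /andP[/term_ge0//]].
  have [->|yx] := eqVneq y x; first exact: phix.
  have := h y (mem_index_enum _); rewrite yX yx /= mulf_eq0 invr_eq0.
  rewrite (gt_eqF (addr_gt0 px (phiX _ yX))) orbF mulf_eq0 (gt_eqF fx)/=.
  by rewrite subr_eq0 => /eqP.
(* Both families have the same positive total, which fixes the common ratio. *)
have r1 : r = 1.
  have sf : \sum_(y in X) f y != 0.
    rewrite gt_eqF// (bigD1 x)//= ltr_pwDl// sumr_ge0// => y _; exact: hf.
  apply: (mulIf sf); rewrite mul1r mulr_sumr -[RHS]sumphi.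
  by apply: eq_bigr => y /eqphi.
by move=> y /eqphi; rewrite r1 mul1r.
Qed.

(** With [phi = f] the turnover [f x + f y] cancels the denominator, so the equations hold term by
    term. *)
Lemma row_constant_rates (X : {set A}) :
  (forall x, x \in X -> 0 < f x) -> (forall x, x \notin X -> f x = 0) ->
  rates_on_component vp (\sum_(x in X) f x) X f.
Proof.
move=> fX fXC; split=> // x xX; apply: eq_bigr => y /andP[yX yx].
rewrite /turnovers !hvp// 1?eq_sym// mulrCA divff ?mulr1//.
by rewrite gt_eqF// addr_gt0// fX.
Qed.

End RowConstantScores.

Theorem proposition12p4 (R : realType) (A : finType) (hA : (2 <= #|A|)%N)
    (f : A -> R) (F : R) (v : A -> A -> R)
    (hf : forall x : A, 0 <= f x)
    (hF : \sum_(x : A) f x = F) (hF1 : F <= 1)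
    (hv : forall x y : A, y != x -> v x y = f x)
    (phi : A -> R) :
  fraction_like_rates v F phi <-> (forall x : A, phi x = f x).
Proof.
have v0E := plumping_zero_scores hv hA.
have f1 : \sum_x f x <= 1 by rewrite hF.
pose S := [set x | 0 < f x]%SET.
have fS x : x \in S -> 0 < f x by rewrite inE.
have fSC x : x \notin S -> f x = 0.
  by rewrite inE lt_neqAle hf andbT negbK => /eqP.
(* The support carries the whole sum, so the normalization over the component agrees with [F]. *)
have sumS : \sum_(x in S) f x = F.
  by rewrite -hF [RHS](bigID (mem S))/= [X in _ + X]big1 ?addr0.
have ex_neq0 : ~ zero_scores v -> exists x, f x != 0.
  move=> nv0; apply: contrapT => nex; apply: nv0; apply/v0E => x.
  by apply/eqP/negPn/negP => fx; apply: nex; exists x.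
have topE xi tau X : ~ zero_scores v -> admissible_order v xi ->
    projected_turnovers v xi tau ->
    top_dominant_component (projected_scores v xi tau) X <-> X = S.
  move=> /ex_neq0 nz adm ptau; apply: (row_constant_top_dominant_component (f := f)) => //.
  by move=> x y; apply: plumping_projected_scores.
split=> [[h0 h1] x|phiE].
  have [/[dup] v0 /v0E f0|nv0] := pselect (zero_scores v); first by rewrite h0// f0.
  have [xi [tau [X [adm ptau /(topE _ _ _ nv0 adm ptau) XS rates]]]] := h1 nv0.
  move: rates; rewrite {X}XS => rates.
  have [xS|xS] := boolP (x \in S); last by rewrite fSC//; case: rates => ->.
  move: rates; rewrite -sumS => rates.
  apply: (row_constant_rates_unique _ _ _ fS rates) => //.
  - by move=> y z; apply: plumping_projected_scores.
  - by apply/set0Pn; exists x.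
have -> : phi = f by apply/funext.
split=> [/v0E//|nv0]; have [xi adm] := plumping_admissible_order_exists hv.
(* For the converse the original turnovers serve as witness: they are feasible and at distance 0
   from themselves. *)
have ptau : projected_turnovers v xi (turnovers v).
  split=> [|tau' _]; first exact: plumping_feasible_turnovers.
  rewrite {1}/square_distance big1 => [|p _]; last by rewrite subrr expr0n.
  by apply: sumr_ge0 => p _; apply: sqr_ge0.
exists xi, (turnovers v), S; split=> //; first exact/topE.
rewrite -sumS; apply: row_constant_rates => // x y.
exact: plumping_projected_scores.
Qed.
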